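(* Let $(B_1,B_2)$ be a B-ESG rewrite pattern and let $S\Rightarrow^{G_1}_{v_1,p_1}H_1\Rightarrow^{G_1}_{v_2,p_2}\cdots\Rightarrow^{G_1}_{v_n,p_n}H_n\Rightarrow^T_*F$ and $S\Rightarrow^{G_2}_{v_1,p_1}H'_1\Rightarrow^{G_2}_{v_2,p_2}\cdots\Rightarrow^{G_2}_{v_n,p_n}H'_n\Rightarrow^T_*F'$ be a B-ESG pattern instantiation. Then $F$ and $F'$ are string graphs with the same set of inputs and the same set of outputs; that is, the instantiation is a string graph rewrite rule $F\leftarrow I\rightarrow F'$ with $I$ the common boundary.
   Context: Graphs: a graph over $\Sigma,\Gamma$ is $H=(V,E,\lambda)$ with $V$ finite, $E\subseteq\{(v,\gamma,w): v\neq w,\gamma\in\Gamma\}$, $\lambda:V\to\Sigma$. A graph with embedding is $(D,C)$ with $C\subseteq\Sigma\times\Gamma\times\Gamma\times V_D\times\{in,out\}$, elements written $(\sigma,\beta/\gamma,x,d)$. An edNCE grammar $G=(\Sigma,\Delta,\Gamma,\Omega,P,S)$ has terminal labels $\Delta$, final edge labels $\Omega$, finitely many productions $X\to(D,C)$ ($X$ non-terminal) and initial non-terminal $S$. Applying $X\to(D,C)$ to an $X$-labelled vertex $v$: delete $v$, add a copy of $D$, and for every $\beta$-edge between $v$ and a $\sigma$-labelled vertex $w$ directed into $v$ ($d=in$) or out of $v$ ($d=out$) and each $(\sigma,\beta/\gamma,x,d)\in C$, add a $\gamma$-edge between $w$ and $x$ ($w\to x$ if $d=in$, $x\to w$ if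 $d=out$). $H\Rightarrow_{v,p}H'$ denotes applying production $p$ at vertex $v$. Derivations start from a single $S$-labelled vertex. B-edNCE: production bodies have no adjacent non-terminals and no instruction has non-terminal $\sigma$. String graphs: for disjoint label sets $\mathcal N$ (node-vertices), $\mathcal W$ (wire-vertices), a string graph is a directed graph labelled in $\mathcal N\cup\mathcal W$ with no edge between node-vertices and all wire-vertices of in- and out-degree at most one. Inputs/outputs: wire-vertices with no incoming/outgoing edges; the boundary is the set of inputs and outputs. A string graph rewrite rule is a span $L\leftarrow I\rightarrow R$ of string graphs where $I$ is the common boundary of $L$ and $R$. Encoded string graph: a string graph where edges labelled by encoding symbols $\alpha\in\mathcal E$ ($\mathcal E$ finite) may additionally join node-vertices. Decoding system $T$: for each $(\alpha,N_1,N_2)\in\mathcal E\times\mathcal N\times\mathcal N$ one DPO rule replacing a single $\alpha$-edge from an $N_1$ node-vertex to an $N_2$ node-vertex (interface: the two node-vertices) by a connected string graph with no inputs, outputs or encoding labels; decoding means rewriting with $T$ until no encoding edge remains. B-ESG grammar $B=(G,T)$: $T$ a decoding system, $G=(\Sigma,\Delta,\Gamma,\Gamma,P,S)$ B-edNCE with $\Delta=\mathcal N\cup\mathcal W$, $\mathcal E\subseteq\Gamma$, and for each production $X\to(D,C)$: (N1) an edge of $D$ has encoding label iff it joins two node-vertices; (N2) instructions $(N,\alpha/\beta,x,d)$ with $N\in\mathcal N$, $x$ a node-vertex have $\beta\in\mathcal E$; (W1) wire-vertices of $D$ have in- and out-degree at most one; (W2) no instruction $(\sigma,\alpha/\beta,x,d)$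 has $x$ a wire-vertex; (W3) for each $W\in\mathcal W,\gamma,d$ at most one instruction $(W,\gamma/\delta,x,d)$, and $\delta\notin\mathcal E$; (W4) if a non-terminal $y$ with label $Y$ in $D$ is adjacent to a $W$-labelled wire-vertex via an edge of direction $d$ and label $\beta$, or there is an instruction $(W,\alpha/\beta,y,d)$, then all productions for $Y$ contain an instruction $(W,\beta/\gamma,z,d)$. B-ESG rewrite pattern: a pair of B-ESG grammars $B_1=(G_1,T)$, $B_2=(G_2,T)$ with $G_i=(\Sigma,\Delta,\Gamma,\Gamma,P_i,S)$ (same alphabets, same decoding system, same initial non-terminal), together with a bijective correspondence between $P_1$ and $P_2$ pairing productions $X\to(D_1,C_1)$ and $X\to(D_2,C_2)$ with the same left-hand side, such that for each corresponding pair: (NT) there is a label-preserving bijection between the non-terminal vertices of $D_1$ and those of $D_2$; (IO) there is a bijection between the inputs (resp. outputs) of $D_1$ and the inputs (resp. outputs) of $D_2$. Corresponding inputs/outputs/non-terminals are identified (given the same names). A B-ESG pattern instantiation of $(B_1,B_2)$ is a pair of concrete derivations using the identical sequence of (vertex, production) pairs $(v_i,p_i)$ in $G_1$ and $G_2$ (with $p_i$ interpreted via the correspondence and $v_i$ via the identification of corresponding non-terminals), ending in graphs $H_n,H'_n$ without non-terminals, which are then decoded with $T$ to $F$ and $F'$. Vertices of $F$ and $F'$ arising from corresponding (identified) vertices are identified.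
   Formalization: That the instantiation is a rewrite rule F ← I → F' is proved assuming the (IO) bijections preserve wire-vertex labels; otherwise it fails (S → one isolated W1-wire paired with S → one isolated W2-wire). The claims on string graphs, inputs and outputs need no such assumption. *)

(* Defs.v *)
From HB Require Import structures.
From mathcomp Require Import all_boot finmap.
From Stdlib Require Relation_Operators List.

Set Implicit Arguments.
Unset Strict Implicit.
Unset Printing Implicit Defensive.

Local Open Scope fset_scope.

(** * Graphs over [Sigma] (vertex labels) and [Gamma] (edge labels) *)

(* Vertices are names drawn from [K], so that vertices of two different graphs
   can be the same vertex.  The values of [lab] outside [vset] are meaningless
   and are never used. *)
Record graph (K : choiceType) (Sigma Gamma : finType) := Graph {
  vset : {fset K};
  edges : {fset K * Gamma * K};
  lab : K -> Sigma;
  edges_ok : forall v g w, (v, g, w) \in edges ->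
    [/\ v \in vset, w \in vset & v != w] }.

Inductive dir := In | Out.

Definition bool_of_dir d := if d is In then true else false.
Definition dir_of_bool b := if b then In else Out.
Lemma bool_of_dirK : cancel bool_of_dir dir_of_bool.
Proof. by case. Qed.
HB.instance Definition _ := Countable.copy dir (can_type bool_of_dirK).

Section Graphs.
Context {K : choiceType} {Sigma Gamma : finType}.
Implicit Types G H I L R : graph K Sigma Gamma.

Definition adj G : rel K := fun x y =>
  [exists g, ((x, g, y) \in edges G) || ((y, g, x) \in edges G)].

Definition indeg G v := #|` [fset e in edges G | e.2 == v]|.
Definition outdeg G v := #|` [fset e in edges G | e.1.1 == v]|.

Definition connected G := forall x y, x \in vset G -> y \in vset G ->
  exists2 p, path (adj G) x p & last x p = y.

Definition map_edges (f : K -> K) (A : {fset K * Gamma * K}) :=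
  [fset (f e.1.1, e.1.2, f e.2) | e in A].

Lemma discrete_ok (A : {fset K}) (v : K) (g : Gamma) (w : K) :
  (v, g, w) \in (fset0 : {fset K * Gamma * K}) ->
  [/\ v \in A, w \in A & v != w].
Proof. by rewrite in_fset0. Qed.

Definition discrete (A : {fset K}) (l : K -> Sigma) : graph K Sigma Gamma :=
  Graph l (@discrete_ok A).

Definition inclusion G H :=
  [/\ vset G `<=` vset H, edges G `<=` edges H & {in vset G, lab H =1 lab G}].

Definition embedding (m : K -> K) G H :=
  [/\ {in vset G &, injective m},
      {in vset G, forall x, m x \in vset H},
      {in vset G, forall x, lab H (m x) = lab G x} &
      map_edges m (edges G) `<=` edges H].

Definition bij_on (f : K -> K) (A B : {fset K}) :=
  {in A &, injective f} /\ [fset f x | x in A] = B.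

End Graphs.

(** * Double pushout rewriting *)

(* The span [span_l <- span_i -> span_r], both legs being inclusions. *)
Record span (K : choiceType) (Sigma Gamma : finType) := Span {
  span_l : graph K Sigma Gamma;
  span_i : graph K Sigma Gamma;
  span_r : graph K Sigma Gamma;
  span_il : inclusion span_i span_l;
  span_ir : inclusion span_i span_r }.

(* [m] is the match and [n] the comatch.  The pushout complement is
   [H - m (L - I)]; the pushout adds a fresh copy of [R - I] to it. *)
Definition dpo_step (K : choiceType) (Sigma Gamma : finType)
    (r : span K Sigma Gamma) (H H' : graph K Sigma Gamma) : Prop :=
  let L := span_l r in let I := span_i r in let R := span_r r in
  exists m n : K -> K,
  [/\ embedding m L H,
      (* dangling condition *)
      (forall x v g w, x \in vset L `\` vset I -> (v, g, w) \in edges H ->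
         m x = v \/ m x = w -> (v, g, w) \in map_edges m (edges L)),
      {in vset R &, injective n},
      {in vset I, n =1 m} &
      {in vset R `\` vset I, forall x, n x \notin vset H}] /\
  [/\ vset H' = (vset H `\` [fset m x | x in vset L `\` vset I])
                `|` [fset n x | x in vset R],
      edges H' = (edges H `\` map_edges m (edges L `\` edges I))
                 `|` map_edges n (edges R),
      {in vset H `&` vset H', forall x, lab H' x = lab H x} &
      {in vset R, forall x, lab H' (n x) = lab R x}].

(** * edNCE grammars *)

(* The instruction [(s, b/c, x, d)] is the tuple [(s, b, c, x, d)]. *)
Record egraph (K : choiceType) (Sigma Gamma : finType) := EGraph {
  egr :> graph K Sigma Gamma;
  emb : {fset Sigma * Gamma * Gamma * K * dir};
  emb_ok : forall s b c x d, (s, b, c, x, d) \in emb -> x \in vset egr }.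

(* Productions are indexed by the finite type [prods]. *)
Record edNCE (K : choiceType) (Sigma Gamma : finType) := EdNCE {
  Delta : {set Sigma};
  Omega : {set Gamma};
  prods : finType;
  lhs : prods -> Sigma;
  rhs : prods -> egraph K Sigma Gamma;
  init : Sigma;
  lhs_nt : forall p, lhs p \notin Delta;
  init_nt : init \notin Delta }.

Section Grammars.
Context {K : choiceType} {Sigma Gamma : finType}.
Implicit Types (H : graph K Sigma Gamma) (G : edNCE K Sigma Gamma).

Definition nonterminals (Dl : {set Sigma}) H :=
  [fset x in vset H | lab H x \notin Dl].

(* [H =>_(v,p) H'], where the copy of the body of [p] that replaces [v] has its
   vertices named by [rho]. *)
Definition apply_prod G H (v : K) (p : prods G) (rho : K -> K) H' : Prop :=
  let D := rhs p in
  [/\ v \in vset H, lab H v = lhs p,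
      {in vset D &, injective rho} &
      {in vset D, forall x, rho x \notin vset H}] /\
  [/\ vset H' = (vset H `\ v) `|` [fset rho x | x in vset D],
      {in vset H `\ v, forall x, lab H' x = lab H x},
      {in vset D, forall x, lab H' (rho x) = lab D x} &
      forall a c b, (a, c, b) \in edges H' <->
        [\/ [/\ (a, c, b) \in edges H, a != v & b != v],
            (a, c, b) \in map_edges rho (edges D),
            (exists beta x, [/\ (a, beta, v) \in edges H,
               (lab H a, beta, c, x, In) \in emb D & b = rho x]) |
            (exists beta x, [/\ (v, beta, b) \in edges H,
               (lab H b, beta, c, x, Out) \in emb D & a = rho x])]].

Inductive derives G :
    graph K Sigma Gamma -> seq (K * prods G * (K -> K)) ->
    graph K Sigma Gamma -> Prop :=
| derives_nil H : derives H [::] H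
| derives_cons H v p rho H1 s H2 :
    apply_prod H v p rho H1 -> derives H1 s H2 ->
    derives H ((v, p, rho) :: s) H2.

Definition start_graph G (v0 : K) : graph K Sigma Gamma :=
  discrete [fset v0] (fun=> init G).

Definition boundary_grammar G := forall p : prods G,
  let D := rhs p in
  (forall x y, x \in nonterminals (Delta G) D ->
     y \in nonterminals (Delta G) D -> ~~ adj D x y) /\
  (forall s b c x d, (s, b, c, x, d) \in emb D -> s \in Delta G).

End Grammars.

(** * String graphs *)

Record signature (Sigma Gamma : finType) := Signature {
  Nd : {set Sigma};
  Wr : {set Sigma};
  Enc : {set Gamma};
  NdWr_disjoint : Nd :&: Wr = set0 }.

Section StringGraphs.
Context {K : choiceType} {Sigma Gamma : finType}.
Variable sg : signature Sigma Gamma.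
Implicit Types G L I R : graph K Sigma Gamma.

Definition degree_le1 G v := (indeg G v <= 1) /\ (outdeg G v <= 1).

Definition string_graph G : Prop :=
  [/\ {in vset G, forall v, lab G v \in Nd sg :|: Wr sg},
      (forall v g w, (v, g, w) \in edges G ->
         ~ (lab G v \in Nd sg /\ lab G w \in Nd sg)) &
      {in vset G, forall v, lab G v \in Wr sg -> degree_le1 G v}].

Definition inputs G :=
  [fset v in vset G | (lab G v \in Wr sg) && (indeg G v == 0)].
Definition outputs G :=
  [fset v in vset G | (lab G v \in Wr sg) && (outdeg G v == 0)].
Definition boundary G := inputs G `|` outputs G.

(* [I] is discrete: the boundary is a set of vertices. *)
Definition string_graph_rewrite_rule (r : span K Sigma Gamma) : Prop :=
  let L := span_l r in let I := span_i r in let R := span_r r in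
  [/\ string_graph L, string_graph I & string_graph R] /\
  [/\ edges I = fset0, vset I = boundary L, vset I = boundary R,
      inputs L = inputs R & outputs L = outputs R].

(** * Decoding systems *)

Definition no_encoding_edge G := forall v g w,
  (v, g, w) \in edges G -> g \notin Enc sg.

Definition decoding_rule (alpha : Gamma) (N1 N2 : Sigma)
    (r : span K Sigma Gamma) : Prop :=
  let L := span_l r in let I := span_i r in let R := span_r r in
  exists a b : K,
  [/\ vset L = [fset a; b], edges L = [fset (a, alpha, b)],
      lab L a = N1 & lab L b = N2] /\
  [/\ vset I = [fset a; b] & edges I = fset0] /\
  [/\ string_graph R, connected R, inputs R = fset0, outputs R = fset0 &
      no_encoding_edge R].

(* Only the values at [Enc sg], [Nd sg] and [Nd sg] are relevant. *)
Definition decoding_data := Gamma -> Sigma -> Sigma -> span K Sigma Gamma.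

Definition decoding_system (T : decoding_data) : Prop :=
  forall alpha N1 N2, alpha \in Enc sg -> N1 \in Nd sg -> N2 \in Nd sg ->
  decoding_rule alpha N1 N2 (T alpha N1 N2).

Definition decoding_step (T : decoding_data) G G' : Prop :=
  exists alpha N1 N2,
    [/\ alpha \in Enc sg, N1 \in Nd sg, N2 \in Nd sg &
        dpo_step (T alpha N1 N2) G G'].

Definition decodes (T : decoding_data) G F : Prop :=
  Relation_Operators.clos_refl_trans (graph K Sigma Gamma) (decoding_step T) G F
  /\ no_encoding_edge F.

(** * B-ESG grammars *)

Section Conditions.
Variable D : egraph K Sigma Gamma.

Definition condN1 := forall v g w, (v, g, w) \in edges D ->
  (g \in Enc sg <-> lab D v \in Nd sg /\ lab D w \in Nd sg).

Definition condN2 := forall N alpha beta x d,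
  (N, alpha, beta, x, d) \in emb D -> N \in Nd sg -> lab D x \in Nd sg ->
  beta \in Enc sg.

Definition condW1 := {in vset D, forall v, lab D v \in Wr sg -> degree_le1 D v}.

Definition condW2 := forall s alpha beta x d,
  (s, alpha, beta, x, d) \in emb D -> lab D x \notin Wr sg.

Definition condW3 := forall W gamma d, W \in Wr sg ->
  (forall delta x delta' x',
     (W, gamma, delta, x, d) \in emb D -> (W, gamma, delta', x', d) \in emb D ->
     delta = delta' /\ x = x') /\
  (forall delta x, (W, gamma, delta, x, d) \in emb D -> delta \notin Enc sg).

(* Directions are relative to the non-terminal [y]: [In] is [w -> y]. *)
Definition adjacent_via (y : K) (W : Sigma) (beta : Gamma) (d : dir) :=
  exists2 w, lab D w = W &
    if d is In then (w, beta, y) \in edges D else (y, beta, w) \in edges D.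

Definition condW4 (G : edNCE K Sigma Gamma) := forall y W beta d,
  y \in nonterminals (Delta G) D -> W \in Wr sg ->
  (adjacent_via y W beta d \/ exists alpha, (W, alpha, beta, y, d) \in emb D) ->
  forall q : prods G, lhs q = lab D y ->
  exists gamma z, (W, beta, gamma, z, d) \in emb (rhs q).

End Conditions.

Definition besg_grammar (G : edNCE K Sigma Gamma) (T : decoding_data) : Prop :=
  [/\ decoding_system T, boundary_grammar G, Delta G = Nd sg :|: Wr sg,
      Omega G = [set: Gamma] &
      forall p : prods G, let D := rhs p in
        [/\ condN1 D, condN2 D, condW1 D & condW2 D] /\
        [/\ condW3 D & condW4 D G]].

End StringGraphs.

Arguments decoding_data : clear implicits.

(** * B-ESG rewrite patterns *)

(* [nt_map p], [in_map p] and [out_map p] are the bijections between the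
   non-terminals, inputs and outputs of the body of [p] and those of the body
   of the corresponding production [corr p]. *)
Record besg_pattern (K : choiceType) (Sigma Gamma : finType)
    (sg : signature Sigma Gamma) := BESGPattern {
  gram1 : edNCE K Sigma Gamma;
  gram2 : edNCE K Sigma Gamma;
  decT : decoding_data K Sigma Gamma;
  besg1 : besg_grammar sg gram1 decT;
  besg2 : besg_grammar sg gram2 decT;
  same_init : init gram1 = init gram2;
  corr : prods gram1 -> prods gram2;
  corr_bij : bijective corr;
  corr_lhs : forall p, lhs (corr p) = lhs p;
  nt_map : prods gram1 -> K -> K;
  in_map : prods gram1 -> K -> K;
  out_map : prods gram1 -> K -> K;
  condNT : forall p, let D1 := rhs p in let D2 := rhs (corr p) in
    bij_on (nt_map p) (nonterminals (Delta gram1) D1)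
                      (nonterminals (Delta gram2) D2) /\
    {in nonterminals (Delta gram1) D1,
       forall x, lab D2 (nt_map p x) = lab D1 x};
  condIO : forall p, let D1 := rhs p in let D2 := rhs (corr p) in
    bij_on (in_map p) (inputs sg D1) (inputs sg D2) /\
    bij_on (out_map p) (outputs sg D1) (outputs sg D2) }.

Section Patterns.
Context {K : choiceType} {Sigma Gamma : finType} {sg : signature Sigma Gamma}.
Variable B : besg_pattern K sg.

(* The copies of the two bodies, named by [rho1] and [rho2], give corresponding
   vertices the same name. *)
Definition identified (p : prods (gram1 B)) (rho1 rho2 : K -> K) : Prop :=
  let D := rhs p in
  [/\ {in nonterminals (Delta (gram1 B)) D,
         forall x, rho2 (nt_map p x) = rho1 x},
      {in inputs sg D, forall x, rho2 (in_map p x) = rho1 x} &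
      {in outputs sg D, forall x, rho2 (out_map p x) = rho1 x}].

(* One step [((v, p), (rho1, rho2))] applies [p] resp. [corr p] at the same
   vertex [v] in both derivations. *)
Definition pattern_step : Type :=
  (K * prods (gram1 B)) * ((K -> K) * (K -> K)).

Definition step1 (st : pattern_step) := (st.1.1, st.1.2, st.2.1).
Definition step2 (st : pattern_step) := (st.1.1, corr st.1.2, st.2.2).

(* [S =>* Hn =>* F] in [(gram1, decT)] and [S =>* Hn' =>* F'] in
   [(gram2, decT)], with the steps [s]. *)
Definition pattern_instantiation (v0 : K) (s : seq pattern_step)
    (Hn F Hn' F' : graph K Sigma Gamma) : Prop :=
  [/\ List.Forall (fun st => identified st.1.2 st.2.1 st.2.2) s,
      derives (start_graph (gram1 B) v0) [seq step1 st | st <- s] Hn &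
      derives (start_graph (gram2 B) v0) [seq step2 st | st <- s] Hn'] /\
  [/\ nonterminals (Delta (gram1 B)) Hn = fset0,
      nonterminals (Delta (gram2 B)) Hn' = fset0,
      decodes sg (decT B) Hn F & decodes sg (decT B) Hn' F'].

(* The identification respects wire labels (automatic for a single wire
   label); this is not part of [condIO]. *)
Definition io_labels_agree : Prop := forall p : prods (gram1 B),
  let D1 := rhs p in let D2 := rhs (corr p) in
  {in inputs sg D1, forall x, lab D2 (in_map p x) = lab D1 x} /\
  {in outputs sg D1, forall x, lab D2 (out_map p x) = lab D1 x}.

End Patterns.

(* Main.v *)
Require Import Defs.
From mathcomp Require Import all_boot finmap.
From Stdlib Require List.

(* Consider sentential forms in which wire-vertices have in- and out-degree at
   most one, edges between node-vertices are encoding edges, and every wire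
   attached to a non-terminal is served by an instruction of each production for
   that non-terminal.  (N1)-(W4) make these properties invariant.  When [v] is
   replaced, a wire attached to [v] is reattached by exactly one instruction (at
   least one by (W4), at most one by (W3)) and the new wires keep the degrees
   they have in the body, by (W2).  So a step only adds the inputs and outputs of
   the body, which are the same vertices in both derivations.  Decoding touches
   no old wire and creates no input or output. *)

Set Implicit Arguments.
Unset Strict Implicit.
Unset Printing Implicit Defensive.

Local Open Scope fset_scope.

(** * Edges and degrees at a vertex, uniformly in the direction *)

Definition opp_dir (d : dir) : dir := if d is In then Out else In.

Lemma cardfs_le1P (T : choiceType) (A : {fset T}) :
  reflect {in A &, forall x y, x = y} (#|` A| <= 1).
Proof.
apply: (iffP idP) => [|uni].
  case: (posnP #|` A|) => [/cardfs0_eq-> _ x y //|A0 A1 x y].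
  have /cardfs1P[z ->] : #|` A| == 1 by rewrite eqn_leq A1.
  by rewrite !inE => /eqP-> /eqP->.
case: (fset_0Vmem A) => [->|[x xA]]; first by rewrite cardfs0.
rewrite -(cardfs1 x) fsubset_leq_card //; apply/fsubsetP => y yA.
by rewrite inE (uni y x).
Qed.

Section Arcs.
Context {K : choiceType} {Sigma Gamma : finType}.
Implicit Types (G H : graph K Sigma Gamma) (A : {fset K * Gamma * K}) (d : dir).

(* The edge between [x] and [y] that has direction [d] relative to [y]. *)
Definition arc d (x : K) (g : Gamma) (y : K) : K * Gamma * K :=
  if d is In then (x, g, y) else (y, g, x).

Lemma arc_opp d x g y : arc (opp_dir d) x g y = arc d y g x.
Proof. by case: d. Qed.

Lemma arc_inj d x g y x' g' y' :
  arc d x g y = arc d x' g' y' -> [/\ x = x', g = g' & y = y'].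
Proof. by case: d => -[-> -> ->]. Qed.

Lemma arc_ok d G x g y : arc d x g y \in edges G ->
  [/\ x \in vset G, y \in vset G & x != y].
Proof.
by case: d => /edges_ok[xG yG xy]; split=> //; rewrite eq_sym.
Qed.

Lemma mem_map_edges d (f : K -> K) A a g b :
  reflect (exists x y, [/\ arc d x g y \in A, a = f x & b = f y])
          (arc d a g b \in map_edges f A).
Proof.
apply: (iffP (imfsetP _ _ _ _)) => [[[[x g'] y] /= xyA]|[x [y [xyA -> ->]]]].
  by case: d => -[-> -> ->]; [exists x, y|exists y, x].
by case: d xyA => xyA; [exists (x, g, y)|exists (y, g, x)].
Qed.

(** The case split makes [deg In] and [deg Out] unfold to [indeg] and [outdeg], so facts stated for
    an arbitrary [d] specialise by conversion. *)
Definition incident d G v : {fset K * Gamma * K} :=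
  if d is In then [fset e in edges G | e.2 == v]
  else [fset e in edges G | e.1.1 == v].

Lemma mem_incident d G v e : reflect
  (exists x g, e = arc d x g v /\ arc d x g v \in edges G)
  (e \in incident d G v).
Proof.
case: e => -[x g] y; case: d; rewrite !inE /=; apply: (iffP andP).
- by case=> xy /eqP <-; exists x, g.
- by case=> x' [g' [[-> -> ->]] xy]; split.
- by case=> xy /eqP <-; exists y, g.
- by case=> x' [g' [[-> -> ->]] xy]; split.
Qed.

Definition deg d G v := #|` incident d G v|.

Lemma deg_le1P d G v : reflect
  (forall x g x' g', arc d x g v \in edges G -> arc d x' g' v \in edges G ->
     x = x' /\ g = g')
  (deg d G v <= 1).
Proof.
apply: (iffP (cardfs_le1P _)) => [uni x g x' g' e1 e2|uni e e'].
  have /arc_inj[//] : arc d x g v = arc d x' g' v.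
  by apply: uni; apply/mem_incident; [exists x, g|exists x', g'].
move=> /mem_incident[x [g [-> e1]]] /mem_incident[x' [g' [-> e2]]].
by have [-> ->] := uni _ _ _ _ e1 e2.
Qed.

Lemma deg_eq0P d G v : reflect
  (forall x g, arc d x g v \notin edges G) (deg d G v == 0).
Proof.
rewrite /deg cardfs_eq0; apply: (iffP eqP) => [e0 x g|none].
  apply/negP => xgv; have := in_fset0 (arc d x g v); rewrite -e0 => /negP; apply.
  by apply/mem_incident; exists x, g.
by apply/fsetP => e; rewrite in_fset0; apply/negP => /mem_incident[x [g [_]]]; apply/negP.
Qed.

Lemma degree_le1E G v : degree_le1 G v <-> forall d, deg d G v <= 1.
Proof.
by split=> [[i o] []//|le1]; split; [apply: (le1 In)|apply: (le1 Out)].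
Qed.

End Arcs.

(** * Encoded string graphs and their decoding *)

Section EncodedStringGraphs.
Context {K : choiceType} {Sigma Gamma : finType}.
Variable sg : signature Sigma Gamma.
Implicit Types (G H : graph K Sigma Gamma) (d : dir).

Lemma Nd_notin_Wr x : x \in Nd sg -> x \notin Wr sg.
Proof.
move=> xN; apply/negP => xW.
by have := in_set0 x; rewrite -(NdWr_disjoint sg) inE xN xW.
Qed.

(* [free_ends In] and [free_ends Out] are [inputs] and [outputs] up to
   conversion. *)
Definition free_ends d G :=
  [fset v in vset G | (lab G v \in Wr sg) && (deg d G v == 0)].

Lemma free_endsP d G v : reflect
  [/\ v \in vset G, lab G v \in Wr sg & forall x g, arc d x g v \notin edges G]
  (v \in free_ends d G).
Proof.
rewrite !inE; apply: (iffP and3P); case=> vG vW /deg_eq0P none; split=> //.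
Qed.

Definition wire_degrees_le1 G := forall d w x g x' g', lab G w \in Wr sg ->
  arc d x g w \in edges G -> arc d x' g' w \in edges G -> x = x' /\ g = g'.

Definition node_edges_encoded G := forall x g y, (x, g, y) \in edges G ->
  lab G x \in Nd sg -> lab G y \in Nd sg -> g \in Enc sg.

Definition terminal_labels G :=
  {in vset G, forall v, lab G v \in Nd sg :|: Wr sg}.

Definition encoded_string_graph G :=
  [/\ terminal_labels G, node_edges_encoded G & wire_degrees_le1 G].

Lemma wire_degrees_le1P G :
  wire_degrees_le1 G <->
  {in vset G, forall v, lab G v \in Wr sg -> degree_le1 G v}.
Proof.
split=> [le1 v vG vW|le1 d w x g x' g' wW e1 e2].
  by apply/degree_le1E => d; apply/deg_le1P => *; apply: le1 vW _ _; eassumption.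
have [_ wG _] := arc_ok e1.
by have /degree_le1E/(_ d)/deg_le1P := le1 w wG wW; apply.
Qed.

(** An edge between two node-vertices would carry an encoding label, and none is left. *)
Lemma encoded_string_graph_decoded G :
  encoded_string_graph G -> no_encoding_edge sg G -> string_graph sg G.
Proof.
move=> [labG encG /wire_degrees_le1P degG] noenc; split=> // x g y xy [xN yN].
by have := noenc _ _ _ xy; rewrite (encG _ _ _ xy).
Qed.

(** A rule deletes one edge between node-vertices, deletes no vertex, and glues in a string graph
    along node-vertices only. Old wires keep their edges, and the new wires have the edges they have
    in [R], where none is free. *)
Lemma decoding_step_encoded (T : decoding_data K Sigma Gamma) G G' :
  decoding_system sg T -> encoded_string_graph G -> decoding_step sg T G G' ->
  [/\ encoded_string_graph G', forall d, free_ends d G' = free_ends d G &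
      {in vset G, lab G' =1 lab G}].
Proof.
move=> Tok [labG encG degG] [alpha [N1 [N2 [aE N1N N2N]]]].
move: (Tok _ _ _ aE N1N N2N); case: (T alpha N1 N2) => /= L I R IL IR.
case=> a [b [[/= vL eL la lb] [[vI eI] [[labR nodeR degR] _ inR outR _]]]].
have freeR d : free_ends d R = fset0 by case: d.
have {}degR : wire_degrees_le1 R by apply/wire_degrees_le1P.
case=> m [n [[[/= m_inj mG labm mE] _ n_inj nm n_fresh] [vG' eG' labG' labn]]].
have vLI : vset L = vset I by rewrite vL vI.
have IRv : {subset vset I <= vset R} by case: IR => /fsubsetP.
have mN x : x \in vset I -> lab G (m x) \in Nd sg.
  rewrite -vLI => xL; rewrite labm //; move: xL; rewrite vL !inE.
  by case/orP=> /eqP->; rewrite ?la ?lb.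
have sG' : {subset vset G <= vset G'}.
  by move=> x xG; rewrite vG' vLI fsetDv imfset0 fsetD0 inE xG.
have {}labG' x : x \in vset G -> lab G' x = lab G x.
  by move=> xG; apply: labG'; rewrite inE xG sG'.
have vG'P x : x \in vset G' ->
    x \in vset G \/ exists2 y, y \in vset R & x = n y.
  rewrite vG' vLI fsetDv imfset0 fsetD0 inE; case/orP=> [|/imfsetP[y yR ->]].
    by left.
  by right; exists y.
(* A vertex of [R] whose image is already in [G] lies in the interface, hence maps to a matched
   node-vertex; so all copied wires are fresh. *)
have nG x : x \in vset R -> n x \in vset G -> lab R x \notin Wr sg.
  move=> xR nxG; case xI : (x \in vset I).
    by rewrite -labn // labG' // nm // Nd_notin_Wr ?mN.
  by move: (n_fresh x); rewrite inE xI xR nxG => /(_ isT).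
have arcG' d x g y : arc d x g y \in edges G' ->
    arc d x g y \in edges G \/ arc d x g y \in map_edges n (edges R).
  by rewrite eG' inE => /orP[/fsetDP[]|]; [left|right].
have arc_new d x g y : arc d x g y \in edges R ->
    arc d (n x) g (n y) \in edges G'.
  by move=> xy; rewrite eG' inE; apply/orP; right; apply/mem_map_edges; exists x, y.
(* The deleted edge ends at matched node-vertices, and by [nG] no copied edge ends at an old
   wire. *)
have arc_old d x g w : w \in vset G -> lab G w \in Wr sg ->
    (arc d x g w \in edges G') = (arc d x g w \in edges G).
  move=> wG wW; apply/idP/idP => [/arcG'[//|]|xw].
    case/mem_map_edges=> x' [y [/arc_ok[_ yR _] _ wy]]; subst w.
    by case/negP: (nG _ yR wG); rewrite -labn // labG'.
  rewrite eG' inE; apply/orP; left; rewrite inE xw andbT.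
  apply/mem_map_edges => -[x' [y [/fsetDP[/arc_ok[_ yL _] _] _ wy]]].
  by move: wW; apply/negP; rewrite Nd_notin_Wr // wy mN // -vLI.
have arc_copy d x g y : y \in vset R -> lab R y \in Wr sg ->
    arc d x g (n y) \in edges G' ->
    exists2 x', x = n x' & arc d x' g y \in edges R.
  move=> yR yW /arcG'[/arc_ok[_ nyG _]|].
    by case/negP: (nG _ yR nyG).
  case/mem_map_edges=> x' [y' [xy' -> nyy']]; exists x' => //.
  by have [_ y'R _] := arc_ok xy'; rewrite (n_inj _ _ yR y'R nyy').
split=> //; last first.
  move=> d; apply/fsetP => w; apply/free_endsP/free_endsP; last first.
    case=> wG wW none; split=> [||x g]; rewrite ?labG' ?arc_old //; exact: sG'.
  case=> /vG'P[wG|[y yR ->]] wW none.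
    by rewrite labG' // in wW; split=> // x g; rewrite -arc_old.
  have: y \in free_ends d R.
    apply/free_endsP; split=> // [|x g]; first by rewrite -labn.
    by apply/negP => /arc_new; apply/negP.
  by rewrite freeR.
split.
- move=> x /vG'P[xG|[y yR ->]]; first by rewrite labG' // labG.
  by rewrite labn // labR.
- move=> x g y /(arcG' In)[] xy.
    by have [xG yG _] := arc_ok (d := In) xy; rewrite !labG' //; apply: encG xy.
  case: {xy}(mem_map_edges In _ _ _ _ _ xy) => x' [y' [xy' -> ->]] xN yN.
  have [x'R y'R _] := arc_ok xy'; rewrite !labn // in xN yN.
  by case: (nodeR _ _ _ xy').
- move=> d w x g x' g' wW e1 e2.
  have [_ /vG'P[wG|[y yR wy]] _] := arc_ok e1.
    by rewrite labG' // in wW; rewrite !arc_old // in e1 e2; apply: degG wW e1 e2.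
  subst w; rewrite labn // in wW.
  have [z -> zy] := arc_copy _ _ _ _ yR wW e1.
  have [z' -> zy'] := arc_copy _ _ _ _ yR wW e2.
  by have [-> ->] := degR _ _ _ _ _ _ wW zy zy'.
Qed.

(** Induction on the rewrite sequence. The set of free ends is the same at every stage, so the label
    equalities on it compose. *)
Lemma decodes_encoded (T : decoding_data K Sigma Gamma) G F :
  decoding_system sg T -> encoded_string_graph G -> decodes sg T G F ->
  [/\ string_graph sg F, forall d, free_ends d F = free_ends d G &
      forall d, {in free_ends d G, lab F =1 lab G}].
Proof.
move=> Tok encG [GF noenc].
suff [encF freeF labF] : [/\ encoded_string_graph F,
    forall d, free_ends d F = free_ends d G &
    forall d, {in free_ends d G, lab F =1 lab G}].
  by split=> //; apply: encoded_string_graph_decoded.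
elim: GF encG {noenc} => {G F} [G G' st|G|G1 G2 G3 _ IH1 _ IH2] encG //.
  have [encG' freeG' labG'] := decoding_step_encoded Tok encG st.
  by split=> // d x /free_endsP[xG _ _]; apply: labG'.
have [enc2 free2 lab2] := IH1 encG; have [enc3 free3 lab3] := IH2 enc2.
split=> // [d|d x xG]; first by rewrite free3.
by rewrite (lab3 d) ?free2 // (lab2 d).
Qed.

End EncodedStringGraphs.

(** * The invariant of B-edNCE derivations and the free ends added by a step *)

Section SententialForms.
Context {K : choiceType} {Sigma Gamma : finType}.
Variables (sg : signature Sigma Gamma) (G : edNCE K Sigma Gamma).
Implicit Types (H : graph K Sigma Gamma) (d : dir).

(** Reversing all edges exchanges the two kinds of reattached edges, so one statement serves both
    directions. In the third case the new endpoint is [b]; in the fourth it is [a], and the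
    instruction is read from the opposite side. *)
Lemma apply_prod_arc d H v (p : prods G) rho H' a c b :
  apply_prod H v p rho H' ->
  arc d a c b \in edges H' <->
  [\/ [/\ arc d a c b \in edges H, a != v & b != v],
      arc d a c b \in map_edges rho (edges (rhs p)),
      (exists beta x, [/\ arc d a beta v \in edges H,
         (lab H a, beta, c, x, d) \in emb (rhs p) & b = rho x]) |
      (exists beta x, [/\ arc d v beta b \in edges H,
         (lab H b, beta, c, x, opp_dir d) \in emb (rhs p) & a = rho x])].
Proof.
case=> _ [_ _ _ eH']; case: d => //=; split.
- by case/eH' => [[? ? ?]|?|?|?];
    [apply: Or41|apply: Or42|apply: Or44|apply: Or43].
- by move=> h; apply/eH'; case: h => [[? ? ?]|?|?|?];
    [apply: Or41|apply: Or42|apply: Or44|apply: Or43].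
Qed.

Lemma derives_cons_inv H v (p : prods G) rho s Hn :
  derives H ((v, p, rho) :: s) Hn ->
  exists2 H1, apply_prod H v p rho H1 & derives H1 s Hn.
Proof.
move E: (_ :: _) => t der; case: der E => // H0 v' p' rho' H1 s' H2 st der.
by case=> -> -> -> ->; exists H1.
Qed.

(** This is (W4) for the current graph instead of a production body. It prevents a wire from losing
    its edge, and so becoming free, when its non-terminal neighbour is replaced. *)
Definition wires_served H := forall d w b y, arc d w b y \in edges H ->
  lab H w \in Wr sg -> lab H y \notin Delta G ->
  forall q : prods G, lhs q = lab H y ->
  exists g z, (lab H w, b, g, z, d) \in emb (rhs q).

Definition sentential_form H :=
  [/\ node_edges_encoded sg H, wire_degrees_le1 sg H & wires_served H].

Lemma start_graph_sentential v0 : sentential_form (start_graph G v0).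
Proof.
have none d x g y : arc d x g y \notin edges (start_graph G v0).
  by rewrite in_fset0.
split=> [x g y|d w x g x' g' _|d w b y] e.
- by have := none In x g y; rewrite e.
- by have := none d x g w; rewrite e.
- by have := none d w b y; rewrite e.
Qed.

Lemma start_graph_free_ends (T : decoding_data K Sigma Gamma) d v0 :
  besg_grammar sg G T -> free_ends sg d (start_graph G v0) = fset0.
Proof.
case=> _ _ DE _ _; apply/fsetP => x; rewrite in_fset0.
apply/negP => /free_endsP[_ /= iW _].
by have := init_nt G; rewrite DE inE iW orbT.
Qed.

(** Both claims rest on a description of the edges at a wire of the new graph, given by [arc_old]
    for wires of [H] and by [arc_new] for wires of the body. *)
Lemma apply_prod_sentential (T : decoding_data K Sigma Gamma)
    H v (p : prods G) rho H' :
  besg_grammar sg G T -> sentential_form H -> apply_prod H v p rho H' ->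
  sentential_form H' /\
  forall d, free_ends sg d H' =
    free_ends sg d H `|` [fset rho x | x in free_ends sg d (rhs p)].
Proof.
case=> _ bG DE _ /(_ p)[[N1 N2 /wire_degrees_le1P W1 W2] [W3 W4]].
move=> [encH degH srvH] st; have arcH' d a c b := apply_prod_arc d a c b st.
case: st => -[vH lv rho_inj fresh] [vH' labH' labrho _].
have WD l : l \in Wr sg -> l \in Delta G by rewrite DE inE orbC => ->.
have vW : lab H v \notin Wr sg.
  by apply/negP => /WD; rewrite lv; apply/negP/lhs_nt.
have embD s b c x d : (s, b, c, x, d) \in emb (rhs p) -> x \in vset (rhs p).
  exact: emb_ok.
have old x : x \in vset H -> x != v -> lab H' x = lab H x.
  by move=> xH xv; apply: labH'; rewrite !inE xv.
have new x : x \in vset (rhs p) -> rho x \in vset H'.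
  by move=> xD; rewrite vH'; apply/fsetUP; right; apply: in_imfset.
have rhoN x y : x \in vset (rhs p) -> y \in vset H -> rho x <> y.
  by move=> /fresh/negP xH yH xy; apply: xH; rewrite xy.
have vH'P x : x \in vset H' ->
    (x \in vset H /\ x != v) \/ exists2 y, y \in vset (rhs p) & x = rho y.
  rewrite vH' !inE; case/orP=> [/andP[]|/imfsetP[y yD ->]]; first by left.
  by right; exists y.
have neqv w : lab H w \in Wr sg -> w != v.
  by move=> wW; apply/eqP => wv; case/negP: vW; rewrite -wv.
(* An edge at an old wire either survives or is the reattachment of an edge to [v]; copied edges end
   at fresh vertices. *)
have arc_old d x g w : w \in vset H -> lab H w \in Wr sg ->
    arc d x g w \in edges H' <->
    (arc d x g w \in edges H /\ x != v) \/
    exists beta z, [/\ arc d v beta w \in edges H,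
      (lab H w, beta, g, z, opp_dir d) \in emb (rhs p) & x = rho z].
  move=> wH wW; split=> [/arcH'[[xw xv _]|/mem_map_edges|[b [z [_]]]|]|].
  - by left.
  - by case=> x' [y [/arc_ok[_ yD _] _ wy]]; case: (rhoN _ _ yD wH).
  - by move=> /embD zD wz; case: (rhoN _ _ zD wH).
  - by right.
  case=> [[xw xv]|new_arc]; apply/arcH'; last exact: Or44.
  by apply: Or41; split=> //; apply: neqv.
(* By (W2) no instruction attaches to a wire of the body, so its copy has only copied edges. *)
have arc_new d x g y : y \in vset (rhs p) -> lab (rhs p) y \in Wr sg ->
    arc d x g (rho y) \in edges H' <->
    exists2 x', x = rho x' & arc d x' g y \in edges (rhs p).
  move=> yD yW; split=> [/arcH'[[/arc_ok[_ yH _] _ _]||[b [z [_ ze]]]|]|].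
  - by case: (rhoN _ _ yD yH).
  - case/mem_map_edges=> x' [y' [xy -> yy]]; exists x' => //.
    by have [_ y'D _] := arc_ok xy; rewrite (rho_inj _ _ yD y'D yy).
  - move=> /(rho_inj _ _ yD (embD _ _ _ _ _ ze)) yz; subst z.
    by case/negP: (W2 _ _ _ _ _ ze).
  - by case=> b [z [/arc_ok[_ yH _]]]; case: (rhoN _ _ yD yH).
  by case=> x' -> xy; apply/arcH'; apply: Or42; apply/mem_map_edges; exists x', y.
split; first split.
(* Surviving edges are covered by the invariant, copied ones by (N1), reattached ones by (N2). *)
- move=> x g y /(arcH' In)[[xy xv yv]||[b [z [xv ze ->]]]|[b [z [vy ze ->]]]].
  + have [xH yH _] := arc_ok (d := In) xy.
    by rewrite (old x) // (old y) //; apply: encH xy.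
  + case/(mem_map_edges In)=> x' [y' [xy -> ->]].
    have [x'D y'D _] := arc_ok xy; rewrite !labrho // => xN yN.
    by apply/(N1 _ _ _ xy).
  + have [xH _ xnv] := arc_ok xv; have zD := embD _ _ _ _ _ ze.
    by rewrite (old x) // labrho // => xN zN; apply: N2 ze xN zN.
  + have [_ yH ynv] := arc_ok vy; have zD := embD _ _ _ _ _ ze.
    rewrite (old y) // 1?eq_sym // labrho // => zN yN; exact: N2 ze yN zN.
- move=> d w x g x' g' wW e1 e2.
  have [_ /vH'P[[wH wv]|[y yD wy]] _] := arc_ok e1; last first.
    subst w; rewrite labrho // in wW.
    have [z -> zy] := (proj1 (arc_new _ _ _ _ yD wW)) e1.
    have [z' -> zy'] := (proj1 (arc_new _ _ _ _ yD wW)) e2.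
    by have [-> ->] := W1 _ _ _ _ _ _ wW zy zy'.
  rewrite (old w) // in wW.
  (* A surviving and a reattached edge would give [w] two edges in [H]. Two reattached edges come
     from the same edge of [H], and (W3) leaves one instruction for it. *)
  case: ((proj1 (arc_old _ _ _ _ wH wW)) e1) => [[xw xv]|[b [z [vw ze ->]]]];
  case: ((proj1 (arc_old _ _ _ _ wH wW)) e2) => [[xw' xv']|[b' [z' [vw' ze' ->]]]].
  + exact: degH wW xw xw'.
  + by have [xE _] := degH _ _ _ _ _ _ wW xw vw'; rewrite xE eqxx in xv.
  + by have [xE _] := degH _ _ _ _ _ _ wW xw' vw; rewrite xE eqxx in xv'.
  + have [_ bb] := degH _ _ _ _ _ _ wW vw vw'; subst b'.
    by have [/(_ _ _ _ _ ze ze')[-> ->]] := W3 _ b (opp_dir d) wW.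
(* The two alternatives in (W4) serve the copied edges and the edges reattached to a non-terminal of
   the body; in the last case [w] would be a new wire, against (W2). *)
- move=> d w c y /arcH'[[wy wv yv]||[b [z [wv ze ->]]]|[b [z [vy ze ->]]]].
  + have [wH yH _] := arc_ok wy; rewrite (old w) // (old y) //.
    exact: srvH wy.
  + case/mem_map_edges=> w' [y' [wy -> ->]].
    have [w'D y'D _] := arc_ok wy; rewrite !labrho // => wW yN q qy.
    apply: (W4 y' _ c d _ wW _ q qy); first by rewrite !inE y'D.
    by left; exists w' => //; case: d wy.
  + have [wH _ wnv] := arc_ok wv; have zD := embD _ _ _ _ _ ze.
    rewrite (old w) // labrho // => wW zN q qz.
    apply: (W4 z _ c d _ wW _ q qz); first by rewrite !inE zD.
    by right; exists b.
  + have zD := embD _ _ _ _ _ ze; rewrite labrho // => zW.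
    by case/negP: (W2 _ _ _ _ _ ze).
move=> d; apply/fsetP => w; rewrite inE; apply/idP/orP.
- case/free_endsP=> /vH'P[[wH wv]|[y yD ->]] wW none.
    rewrite (old w) // in wW; left; apply/free_endsP; split=> // x g.
    apply/negP => xw; case: (eqVneq x v) => [xv|xv]; last first.
      by have /negP := none x g; apply; apply/arc_old => //; left.
    (* If [w] was attached to [v], then [wires_served] yields an instruction of [p] that reattaches
       it, so [w] would not be free. Seen from [v], the edge has the opposite direction. *)
    subst x; have [] := srvH (opp_dir d) w g v _ wW _ p (esym lv).
    + by rewrite arc_opp.
    + by rewrite lv lhs_nt.
    move=> g' [z ze]; have /negP := none (rho z) g'; apply.
    by apply/arc_old => //; right; exists g, z.
  right; apply: in_imfset; rewrite labrho // in wW.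
  apply/free_endsP; split=> // x g; apply/negP => xy.
  by have /negP := none (rho x) g; apply; apply/arc_new => //; exists x.
(* A wire without an edge of direction [d] in [H] has none to survive or to be reattached. *)
- case=> [/free_endsP[wH wW none]|/imfsetP[y /free_endsP[yD yW none] ->]].
    have wv := neqv _ wW; have wH' : w \in vset H' by rewrite vH' !inE wv wH.
    apply/free_endsP; split=> //; rewrite ?(old w) // => x g; apply/negP.
    case/(arc_old _ _ _ _ wH wW)=> [[]|[b [z [vw _ _]]]].
      by move=> xw; have /negP := none x g.
    by have /negP := none v b.
  apply/free_endsP; split; rewrite ?new ?labrho // => x g.
  by apply/negP => /(arc_new _ _ _ _ yD yW)[x' _]; apply/negP.
Qed.

Lemma sentential_encoded (T : decoding_data K Sigma Gamma) H :
  besg_grammar sg G T -> sentential_form H ->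
  nonterminals (Delta G) H = fset0 -> encoded_string_graph sg H.
Proof.
case=> _ _ DE _ _ [encH degH _] nt; split=> // x xH; rewrite -DE.
by have := in_fset0 x; rewrite -nt !inE xH /= => /negbFE.
Qed.

End SententialForms.

(** * Parallel derivations of a rewrite pattern *)

Section Patterns.
Context {K : choiceType} {Sigma Gamma : finType} {sg : signature Sigma Gamma}.
Variable B : besg_pattern K sg.
Implicit Types (H : graph K Sigma Gamma) (d : dir).

Definition io_map d (p : prods (gram1 B)) :=
  if d is In then in_map p else out_map p.

Lemma io_map_free_ends d (p : prods (gram1 B)) :
  [fset io_map d p x | x in free_ends sg d (rhs p)] =
  free_ends sg d (rhs (corr p)).
Proof. by case: (condIO p) => -[_ i] [_ o]; case: d. Qed.

Lemma identified_io_map d (p : prods (gram1 B)) rho1 rho2 :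
  identified p rho1 rho2 ->
  {in free_ends sg d (rhs p), forall x, rho2 (io_map d p x) = rho1 x}.
Proof. by case=> _ i o; case: d. Qed.

Lemma io_labels_agree_io_map d (p : prods (gram1 B)) : io_labels_agree B ->
  {in free_ends sg d (rhs p),
     forall x, lab (rhs (corr p)) (io_map d p x) = lab (rhs p) x}.
Proof. by move=> /(_ p)[i o]; case: d. Qed.

(** The label clause is conditional because (IO) matches vertices without comparing their labels. *)
Definition same_free_ends H H' :=
  (forall d, free_ends sg d H = free_ends sg d H') /\
  (io_labels_agree B -> forall d, {in free_ends sg d H, lab H' =1 lab H}).

Lemma apply_prod_same_free_ends H H' v (p : prods (gram1 B)) rho1 rho2 H1 H1' :
  identified p rho1 rho2 ->
  sentential_form sg (gram1 B) H -> sentential_form sg (gram2 B) H' ->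
  apply_prod H v p rho1 H1 -> apply_prod H' v (corr p) rho2 H1' ->
  same_free_ends H H' -> same_free_ends H1 H1'.
Proof.
move=> idp sH sH' st st' [freeE labE].
have [_ free1] := apply_prod_sentential (besg1 B) sH st.
have [_ free1'] := apply_prod_sentential (besg2 B) sH' st'.
(* By (IO) the free ends of the second body are the [io_map] images of those of the first, and the
   identification names both copies alike. *)
have copyE d : [fset rho1 x | x in free_ends sg d (rhs p)] =
    [fset rho2 x | x in free_ends sg d (rhs (corr p))].
  have id_io := identified_io_map idp; rewrite -io_map_free_ends.
  apply/fsetP => w; apply/imfsetP/imfsetP => /= -[x xD ->].
    by exists (io_map d p x); rewrite ?id_io //; apply: in_imfset.
  by case/imfsetP: xD => y /= yD ->; exists y; rewrite ?id_io.
split=> [d|agree d w]; first by rewrite free1 free1' freeE copyE.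
case: st => -[vH lv _ _] [_ labH1 lab1 _].
case: st' => -[_ lv' _ _] [_ labH1' lab1' _].
rewrite free1 inE => /orP[wfree|/imfsetP[x /= xfree ->]].
  have wfree' := wfree; rewrite freeE in wfree'.
  have /free_endsP[wH wW _] := wfree; have /free_endsP[wH' _ _] := wfree'.
  (* A wire label is terminal, while [v] carries the left-hand side of [p]. *)
  have wv : w != v.
    apply/eqP => wv; have := lhs_nt p; rewrite -lv -wv.
    by have [_ _ -> _ _] := besg1 B; rewrite inE wW orbT.
  by rewrite labH1 ?labH1' ?(labE agree d) // !inE wv.
have /free_endsP[xD _ _] := xfree.
have /free_endsP[x'D _ _] : io_map d p x \in free_ends sg d (rhs (corr p)).
  by rewrite -io_map_free_ends; apply: in_imfset.
rewrite lab1 // -(identified_io_map idp xfree) lab1' //.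
exact: io_labels_agree_io_map.
Qed.

(** The starting graphs are arbitrary so that the induction on the common list of steps can restart
    after the first one. *)
Lemma derives_same_free_ends (s : seq (pattern_step B)) H H' Hn Hn' :
  List.Forall (fun st => identified st.1.2 st.2.1 st.2.2) s ->
  derives H [seq step1 st | st <- s] Hn ->
  derives H' [seq step2 st | st <- s] Hn' ->
  sentential_form sg (gram1 B) H -> sentential_form sg (gram2 B) H' ->
  same_free_ends H H' ->
  [/\ sentential_form sg (gram1 B) Hn, sentential_form sg (gram2 B) Hn' &
      same_free_ends Hn Hn'].
Proof.
elim: s H H' => [|[[v p] [rho1 rho2]] s IH] H H' ids der der' sH sH' same.
  by inversion der; inversion der'; subst.
move: ids der der' => /List.Forall_cons_iff[/= idp ids].
case/derives_cons_inv=> H1 st der1 /derives_cons_inv[H1' st' der1'].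
apply: IH ids der1 der1' _ _ _.
- by have [] := apply_prod_sentential (besg1 B) sH st.
- by have [] := apply_prod_sentential (besg2 B) sH' st'.
- exact: apply_prod_same_free_ends st st' same.
Qed.

End Patterns.

(** * The string graph rewrite rule on the common boundary *)

Lemma boundary_span (K : choiceType) (Sigma Gamma : finType)
    (sg : signature Sigma Gamma) (F F' : graph K Sigma Gamma) :
  string_graph sg F -> string_graph sg F' ->
  inputs sg F = inputs sg F' -> outputs sg F = outputs sg F' ->
  {in boundary sg F, lab F' =1 lab F} ->
  exists r : span K Sigma Gamma,
    [/\ span_l r = F, span_r r = F' & string_graph_rewrite_rule sg r].
Proof.
move=> sF sF' iE oE labE.
have bE : boundary sg F = boundary sg F' by rewrite /boundary iE oE.
have bF (F0 : graph K Sigma Gamma) :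
    {subset boundary sg F0 <= vset F0} /\
    {in boundary sg F0, forall x, lab F0 x \in Wr sg}.
  by split=> x; rewrite !inE => /orP[]/and3P[].
(* The interface takes its labels from [F]; the agreement of labels makes the leg into [F'] an
   inclusion as well. *)
pose I : graph K Sigma Gamma := discrete (boundary sg F) (lab F).
have IF : inclusion I F.
  by split; [apply/fsubsetP; case: (bF F)|apply: fsub0set|].
have IF' : inclusion I F'.
  by split; [rewrite /= bE; apply/fsubsetP; case: (bF F')|apply: fsub0set|].
exists (Span IF IF'); split=> //; split; split=> //=.
split=> [x xb|x g y|x xb xW].
- by rewrite inE (proj2 (bF F)) ?orbT.
- by rewrite in_fset0.
- apply/degree_le1E => d; apply/deg_le1P => y g y' g'.
  by rewrite in_fset0.
Qed.

Theorem theorem4 (K : choiceType) (Sigma Gamma : finType)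
    (sg : signature Sigma Gamma) (B : besg_pattern K sg)
    (v0 : K) (s : seq (pattern_step B)) (Hn F Hn' F' : graph K Sigma Gamma)
    (hinst : pattern_instantiation v0 s Hn F Hn' F') :
  [/\ string_graph sg F, string_graph sg F',
      inputs sg F = inputs sg F', outputs sg F = outputs sg F' &
      io_labels_agree B ->
      exists r : span K Sigma Gamma,
        [/\ span_l r = F, span_r r = F' & string_graph_rewrite_rule sg r]].
Proof.
case: hinst => -[ids der der'] [nt nt' dec dec'].
(* The only vertex of either start graph has a non-terminal label, so neither has free ends. *)
have same0 : same_free_ends B (start_graph (gram1 B) v0)
                              (start_graph (gram2 B) v0).
  split=> [d|agree d x].
    by rewrite (start_graph_free_ends _ _ (besg1 B))
               (start_graph_free_ends _ _ (besg2 B)).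
  by rewrite (start_graph_free_ends _ _ (besg1 B)).
have [sH sH' [freeH labH]] := derives_same_free_ends ids der der'
  (start_graph_sentential sg _ v0) (start_graph_sentential sg _ v0) same0.
have Tok : decoding_system sg (decT B) by case: (besg1 B).
have [sF freeF labF] := decodes_encoded Tok (sentential_encoded (besg1 B) sH nt) dec.
have [sF' freeF' labF'] :=
  decodes_encoded Tok (sentential_encoded (besg2 B) sH' nt') dec'.
have freeE d : free_ends sg d F = free_ends sg d F' by rewrite freeF freeF' freeH.
have iE := freeE In; have oE := freeE Out; split=> // agree.
apply: boundary_span => // x.
suff labE d : x \in free_ends sg d F -> lab F' x = lab F x.
  by rewrite inE => /orP[/(labE In)|/(labE Out)].
(* Decoding keeps the labels of free ends, which reduces the claim to [Hn] and [Hn']. *)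
rewrite freeF => xH; rewrite (labF d) // (labF' d) -?freeH //.
exact: labH agree d x xH.
Qed.
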